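(* Let $n\ge1$, let $a_1,\dots,a_n,b_1,\dots,b_n$ be real numbers with $y=\sum_{i=1}^n a_ib_i\neq0$, and let $\widehat y$ be the value of $y$ computed by sequential (left-to-right) evaluation under SR-nearness with $u=\beta^{1-p}$, that is $\widehat y=\widehat s_n$ where $\widehat s_1=a_1b_1(1+\delta_1)$ and $\widehat s_i=(\widehat s_{i-1}+a_ib_i(1+\delta_{2i-2}))(1+\delta_{2i-1})$ for $2\le i\le n$, with $\delta_{2i-2}$ and $\delta_{2i-1}$ the SR-nearness relative errors of the $i$th product and of the corresponding addition (and $\delta_1$ that of the product $a_1b_1$). Then for every $0<\lambda<1$, $$\mathbb P\left(\frac{|\widehat y-y|}{|y|}\le\mathcal K_1\sqrt{\gamma_n(u^2)/\lambda}\right)\ge1-\lambda,$$ where $\mathcal K_1=\dfrac{\sum_{i=1}^n|a_ib_i|}{\left|\sum_{i=1}^n a_ib_i\right|}$ and $\gamma_n(u^2)=(1+u^2)^n-1$.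
   Context: Floating-point numbers: fix a base $\beta\ge2$ and precision $p\ge1$ (integers); $\mathcal F$ is the set of normal floating-point numbers $\pm m\beta^{e-p}$ with $m,e$ integers and $\beta^{p-1}\le m<\beta^p$ (underflow and overflow are ignored, so $e$ ranges over all integers). Put $u=\beta^{1-p}$. For real $x\ne0$, $\lceil x\rceil=\min\{y\in\mathcal F:y\ge x\}$, $\lfloor x\rfloor=\max\{y\in\mathcal F:y\le x\}$, and, for $x\notin\mathcal F$, $\theta(x)=(x-\lfloor x\rfloor)/(\lceil x\rceil-\lfloor x\rfloor)$. SR-nearness (stochastic rounding): for $x\notin\mathcal F\cup\{0\}$, $\mathrm{fl}(x)=\lceil x\rceil$ with probability $\theta(x)$ and $\mathrm{fl}(x)=\lfloor x\rfloor$ with probability $1-\theta(x)$; if $x\in\mathcal F\cup\{0\}$, $\mathrm{fl}(x)=x$. In a sequence of elementary operations $c_k\leftarrow a_k\,\mathrm{op}_k\,b_k$, $\mathrm{op}_k\in\{+,-,*,/\}$, whose operands are data or previously computed values, each rounding is made with these probabilities conditionally on all previous roundings. The relative error $\delta_k$ of the $k$th operation is defined by $\widehat c_k=\mathrm{fl}(\widehat a_k\,\mathrm{op}_k\,\widehat b_k)=(\widehat a_k\,\mathrm{op}_k\,\widehat b_k)(1+\delta_k)$, with $\delta_k=0$ when the exact result is $0$. It is known that $|\delta_k|\le u$ and $\mathbb{E}[\delta_k\mid\delta_1,\dots,\delta_{k-1}]=\mathbb{E}(\delta_k)=0$ for all $k$ (mean independence). Here the operations are performed in the order of the indices $1,2,\dots,2n-1$,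 and input data are used exactly. *)

(* Defs.v *)
From HB Require Import structures.
From mathcomp Require Import all_boot all_order all_algebra.
From mathcomp Require Import all_classical all_reals all_analysis.

Set Implicit Arguments.
Unset Strict Implicit.
Unset Printing Implicit Defensive.

Import Order.TTheory GRing.Theory Num.Theory.

Local Open Scope classical_set_scope.
Local Open Scope ring_scope.

Section FloatingPoint.
Context {R : realType}.
Variables beta p : nat.

(* The exponent ranges over all of int: underflow and overflow are ignored.
   Zero is not a normal number. *)
Definition fp_normal : set R :=
  [set x | exists (s : bool) (m : nat) (e : int),
     (beta ^ (p - 1) <= m < beta ^ p)%N /\
     x = (-1) ^+ s * m%:R * beta%:R ^ (e - p%:Z)].

Definition fp_unit : R := beta%:R ^ (1 - p%:Z).

(* Minimum and maximum, taken as the element of the set that is a lower (upper)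
   bound of it. They exist for x != 0, when 2 <= beta and 1 <= p; the default
   value 0 is then never used. *)
Definition fp_ceil (x : R) : R :=
  let A := [set y | fp_normal y /\ x <= y] in xget 0 (A `&` lbound A).

Definition fp_floor (x : R) : R :=
  let A := [set y | fp_normal y /\ y <= x] in xget 0 (A `&` ubound A).

Definition fp_theta (x : R) : R :=
  (x - fp_floor x) / (fp_ceil x - fp_floor x).

End FloatingPoint.

Section StochasticRounding.
Context {d : measure_display} {T : measurableType d} {R : realType}.
Variables (beta p : nat) (P : probability T R).

Definition cond_prob (A B : set T) : R := fine (P (A `&` B)) / fine (P B).

Variable delta : nat -> {RV P >-> R}.

Definition history (k : nat) (v : nat -> R) : set T :=
  [set t | forall j : nat, (1 <= j < k)%N -> delta j t = v j].

(* [delta k] is the SR-nearness relative error of the k-th operation, whose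
   exact result is [exact v] when the previous errors are v 1, ..., v (k - 1)
   ([exact] is meant to depend on these values only). The computed value is
   x * (1 + delta k). As each rounding takes finitely many values, conditioning
   on the past amounts to conditioning on the histories of positive
   probability. *)
Definition SR_error (k : nat) (exact : (nat -> R) -> R) : Prop :=
  forall v : nat -> R, P (history k v) != 0%E ->
  let x := exact v in
  let Pr (A : set T) := cond_prob A (history k v) in
  [/\ x = 0 -> Pr [set t | delta k t = 0] = 1,
      fp_normal beta p x -> Pr [set t | x * (1 + delta k t) = x] = 1
    & x <> 0 -> ~ fp_normal beta p x ->
      Pr [set t | x * (1 + delta k t) = fp_ceil beta p x] = fp_theta beta p x /\
      Pr [set t | x * (1 + delta k t) = fp_floor beta p x]
        = 1 - fp_theta beta p x].

End StochasticRounding.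

Section InnerProduct.
Context {R : realType}.
Implicit Types a b dl : nat -> R.

(* Sequences are indexed from 1, and only the entries 1, ..., n of the data
   (1, ..., 2n - 1 of the errors) are relevant. *)
Definition inner_prod (n : nat) a b : R := \sum_(1 <= i < n.+1) a i * b i.

(* [computed_sum a b dl i] is the i-th computed partial sum for the rounding
   errors dl; the value at i = 0 is junk. *)
Fixpoint computed_sum a b dl (i : nat) : R :=
  match i with
  | 0 => 0
  | 1 => a 1%N * b 1%N * (1 + dl 1%N)
  | j.+1 => (computed_sum a b dl j + a i * b i * (1 + dl (2 * i - 2)%N))
            * (1 + dl (2 * i - 1)%N)
  end.

Definition cond_number1 (n : nat) a b : R :=
  (\sum_(1 <= i < n.+1) `|a i * b i|) / `|\sum_(1 <= i < n.+1) a i * b i|.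

Definition gamma_err (n : nat) (x : R) : R := (1 + x) ^+ n - 1.

End InnerProduct.

(* Main.v *)
Require Import Defs.
From HB Require Import structures.
From mathcomp Require Import all_boot all_order all_algebra.
From mathcomp Require Import all_classical all_reals all_analysis.
From mathcomp Require Import measurable_realfun ring lra zify.

Import Order.TTheory GRing.Theory Num.Theory.
Local Open Scope classical_set_scope.
Local Open Scope ring_scope.

(** By Markov's inequality it suffices that E (yhat - y)^2 <= gamma_n(u^2) A^2
    with A = sum |a_i b_i|.  Given the past, each error takes two values, has
    mean 0 and is at most u in absolute value, so the conditional expectation of
    a convex quadratic in it grows by at most u^2 times the leading coefficient.
    Hence the expected square, conditional on the errors so far, is bounded by an
    explicit quadratic in the current partial sum, obtained by recursion from the
    last operation to the first.  Writing q = 1 + u^2, the final bound is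
    sum_(i,j) q^(c_ij) p_i p_j - y^2 with p_i = a_i b_i and 0 <= c_ij <= n, which
    is at most (q^n - 1) A^2.  Expectations are never formed: for the event E that
    the error exceeds K, the recursion bounds K^2 P(E /\ H) for every history H. *)

(** * Neighbouring floating-point numbers and the gap between them *)

Lemma exprz_bracket (R : realType) (b x : R) (hb : 1 < b) (hx : 0 < x) :
  exists e : int, b ^ e <= x < b ^ (e + 1).
Proof.
have b0 : 0 < b by lra.
have lnb : 0 < ln b by exact: ln_gt0.
exists (Num.floor (ln x / ln b)).
have xE : x = b `^ (ln x / ln b).
  by rewrite /powR gt_eqF// divfK ?gt_eqF// lnK.
have /andP[h1 h2] := floor_itv (ln x / ln b).
rewrite -!powR_intmul ?(ltW b0)// {2 3}xE; apply/andP; split.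
  by rewrite ler_powR// ltW.
by rewrite /powR gt_eqF// ltr_expR ltr_pM2r.
Qed.

Lemma fp_normalN (R : realType) (beta p : nat) (x : R) :
  fp_normal beta p x -> fp_normal beta p (- x).
Proof.
move=> [s [m [e [hm ->]]]]; exists (~~ s), m, e; split=> //.
by case: s; rewrite /= ?expr1 ?expr0 !mulNr ?mulN1r ?opprK.
Qed.

Section Neighbours.
Context {R : realType} {beta p : nat}.
Hypotheses (hbeta : (2 <= beta)%N) (hp : (1 <= p)%N).

Let B : R := beta%:R.
Let B1 : 1 < B. Proof. by rewrite ltr1n. Qed.
Let B0 : 0 < B. Proof. exact: lt_trans ltr01 B1. Qed.
Let Bz (e : int) : 0 < B ^ e. Proof. exact: exprz_gt0. Qed.
Let BD (e f : int) : B ^ (e + f) = B ^ e * B ^ f.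
Proof. by rewrite expfzDr ?gt_eqF. Qed.

Lemma fp_unit_gt0 : 0 < fp_unit beta p :> R.
Proof. exact: Bz. Qed.

Lemma fp_normal_neq0 (x : R) : fp_normal beta p x -> x != 0.
Proof.
move=> [s [m [e [/andP[hm _] ->]]]]; rewrite !mulf_neq0 ?signr_eq0 ?gt_eqF//.
  by rewrite ltr0n; apply: leq_trans hm; rewrite expn_gt0 (leq_trans _ hbeta).
Qed.

Let Bp1 (e : int) : (beta ^ (p - 1))%N%:R * B ^ (e - p%:Z) = B ^ (e - 1).
Proof. by rewrite natrX exprnP -BD -subzn//; congr (_ ^ _); ring. Qed.

Let Bp (e : int) : (beta ^ p)%N%:R * B ^ (e - p%:Z) = B ^ e.
Proof. by rewrite natrX exprnP -BD; congr (_ ^ _); ring. Qed.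

(** With [e] the exponent of [x] and [w] the spacing of mantissas at that exponent, truncating
    [x / w] gives the mantissa [m] of the lower neighbour, and [m.+1] serves for the upper one. *)
Lemma fp_neighbours_pos (x : R) : 0 < x -> ~ fp_normal beta p x ->
  exists f c : R, [/\ fp_normal beta p f /\ fp_normal beta p c, f < x < c,
    c - f <= fp_unit beta p * `|x|
    & forall y, fp_normal beta p y -> y <= f \/ c <= y].
Proof.
move=> x0 nx; have [e' /andP[]] := exprz_bracket _ _ _ B1 x0.
pose e := e' + 1; have -> : e' = e - 1 by rewrite /e; ring.
rewrite subrK => le_x lt_x.
set w := B ^ (e - p%:Z); have w0 : 0 < w by exact: Bz.
have z0 : 0 <= x / w by rewrite divr_ge0// ltW.
have /andP[] := truncn_itv z0; set m := Num.truncn _ => lem ltm.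
have m_ge : (beta ^ (p - 1) <= m)%N.
  rewrite -ltnS -(ltr_nat R); apply: le_lt_trans ltm.
  by rewrite ler_pdivlMr// Bp1.
have m_lt : (m < beta ^ p)%N.
  by rewrite -(ltr_nat R); apply: le_lt_trans lem _; rewrite ltr_pdivrMr// Bp.
have nf : fp_normal beta p (m%:R * w).
  by exists false, m, e; rewrite expr0 mul1r m_ge m_lt.
have nc : fp_normal beta p (m.+1%:R * w).
  (* If [m.+1] reaches [beta ^ p] it is no longer a mantissa: the upper neighbour is then [B ^ e],
     written with the least mantissa and exponent [e + 1]. *)
  have [m1|m1] := ltnP m.+1 (beta ^ p).
    by exists false, m.+1, e; rewrite expr0 mul1r m1 ltnW.
  have -> : m.+1 = (beta ^ p)%N by apply/eqP; rewrite eqn_leq m1 m_lt.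
  exists false, (beta ^ (p - 1))%N, (e + 1); rewrite expr0 mul1r leqnn; split.
    by rewrite /= ltn_exp2l// ltn_subrL// hp.
  by rewrite Bp Bp1 addrK.
have fx : m%:R * w < x.
  rewrite lt_neqAle -ler_pdivlMr// lem andbT; apply/eqP => E.
  by apply: nx; rewrite -E.
have xc : x < m.+1%:R * w by rewrite -ltr_pdivrMr.
exists (m%:R * w), (m.+1%:R * w); split=> //.
- by rewrite fx.
- rewrite -mulrBl -natrB// subSnn mul1r gtr0_norm//.
  (* The gap is [w], and [B ^ (e - 1) <= x] makes it at most u times [x]. *)
  have -> : w = fp_unit beta p * B ^ (e - 1).
    by rewrite -BD; congr (_ ^ _); ring.
  by rewrite ler_pM2l// fp_unit_gt0.
- move=> y ny; have [|yf] := leP y (m%:R * w); first by left.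
  have [|yc] := leP (m.+1%:R * w) y; first by right.
  (* A normal number strictly between would be positive and have the same exponent [e], so its
     mantissa would lie strictly between [m] and [m.+1]. *)
  exfalso; have mw0 : 0 <= m%:R * w by rewrite mulr_ge0// ltW.
  have y0 : 0 < y := le_lt_trans mw0 yf.
  case: ny => -[] [m' [e2 [/andP[h1 h2] yE]]].
    move: y0; rewrite yE expr1 mulN1r mulNr oppr_gt0 ltNge.
    by rewrite mulr_ge0// ltW.
  rewrite expr0 mul1r in yE.
  have y1 : B ^ (e2 - 1) <= y by rewrite yE -Bp1 ler_pM2r ?ler_nat.
  have y2 : y < B ^ e2 by rewrite yE -[ltRHS]Bp ltr_pM2r ?ltr_nat.
  have f1 : B ^ (e - 1) <= m%:R * w by rewrite -Bp1 ler_pM2r ?ler_nat.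
  have c1 : m.+1%:R * w <= B ^ e by rewrite -Bp ler_pM2r ?ler_nat.
  have E1 : B ^ (e2 - 1) < B ^ e by lra.
  have E2 : B ^ (e - 1) < B ^ e2 by lra.
  rewrite !ltr_eXz2l// in E1 E2.
  have E : e2 = e by apply: le_anti; move: E1 E2; rewrite !ltrBlDr !ltzD1 => -> ->.
  move: yf yc; rewrite yE E -/w !ltr_pM2r// !ltr_nat => a1 a2.
  by move: (leq_trans a2 a1); rewrite ltnn.
Qed.

Lemma fp_neighbours (x : R) : x <> 0 -> ~ fp_normal beta p x ->
  exists f c : R, [/\ fp_normal beta p f /\ fp_normal beta p c, f < x < c,
    c - f <= fp_unit beta p * `|x|
    & forall y, fp_normal beta p y -> y <= f \/ c <= y].
Proof.
move=> /eqP; rewrite neq_lt => /orP[x0|x0] nx; last exact: fp_neighbours_pos.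
have [|/fp_normalN|f [c [[nf nc] /andP[fx xc] cf no]]] :=
  @fp_neighbours_pos (- x).
- by rewrite oppr_gt0.
- by rewrite opprK.
exists (- c), (- f); split.
- by split; exact: fp_normalN.
- by rewrite ltrNl xc ltrNr fx.
- by rewrite opprK addrC -normrN.
- by move=> y /fp_normalN /no[] ?; [right; rewrite lerNl|left; rewrite lerNr].
Qed.

(** The neighbours are the unique extremal elements selected by [xget], so the default 0 does not
    occur. *)
Lemma fp_floor_ceil (x : R) : x <> 0 -> ~ fp_normal beta p x ->
  fp_floor beta p x < x < fp_ceil beta p x /\
  fp_ceil beta p x - fp_floor beta p x <= fp_unit beta p * `|x|.
Proof.
move=> x0 nx; have [f [c [[nf nc] /andP[fx xc] cf no]]] := fp_neighbours _ x0 nx.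
have -> : fp_floor beta p x = f.
  apply: xget_unique => [|y [[ny yx] /(_ f) fy]].
    split; first by split=> //; exact: ltW.
    by move=> y [/no[]// cy yx]; lra.
  have : f <= y by apply: fy; split=> //; exact: ltW.
  by case/no: ny => ? ?; lra.
have -> : fp_ceil beta p x = c.
  apply: xget_unique => [|y [[ny yx] /(_ c) cy]].
    split; first by split=> //; exact: ltW.
    by move=> y [/no[]// cy yx]; lra.
  have : y <= c by apply: cy; split=> //; exact: ltW.
  by case/no: ny => ? ?; lra.
by rewrite fx xc.
Qed.

End Neighbours.

(** * The conditional law of one rounding error, given a history *)

Section RoundingStep.
Context {R : realType} {beta p : nat}.
Hypotheses (hbeta : (2 <= beta)%N) (hp : (1 <= p)%N).
Context {d : measure_display} {T : measurableType d} {P : probability T R}.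
Variable delta : nat -> {RV P >-> R}.

Let u : R := fp_unit beta p.
Let pr (A : set T) : R := fine (P A).

Let pr_fin (A : set T) : measurable A -> P A \is a fin_num.
Proof. exact: fin_num_measure. Qed.

Let pr_ge0 (A : set T) : 0 <= pr A.
Proof. by rewrite fine_ge0. Qed.

Let pr_le (A B : set T) : measurable A -> measurable B -> A `<=` B ->
  pr A <= pr B.
Proof.
by move=> mA mB AB; rewrite fine_le ?pr_fin// le_measure ?inE.
Qed.

Let prU (A B : set T) : measurable A -> measurable B -> A `&` B = set0 ->
  pr (A `|` B) = pr A + pr B.
Proof. by move=> mA mB AB; rewrite /pr measureU// fineD ?pr_fin. Qed.

Lemma measurable_error_eq (k : nat) (x : R) :
  measurable [set t | delta k t = x].
Proof.
rewrite -[X in measurable X]setTI.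
by apply: (measurable_funP (delta k) measurableT [set x]).
Qed.

Lemma historyS (k : nat) (v : nat -> R) : (1 <= k)%N ->
  history delta k.+1 v = [set t | delta k t = v k] `&` history delta k v.
Proof.
move=> k1; apply/seteqP; split=> t /=.
  move=> h; split; first by apply: h; rewrite k1 /=.
  by move=> j /andP[j1 jk]; apply: h; rewrite j1 ltnW.
move=> [hk h] j /andP[j1]; rewrite ltnS leq_eqVlt => /predU1P[->//|jk].
by apply: h; rewrite j1.
Qed.

Lemma history1 (v : nat -> R) : history delta 1 v = setT.
Proof. by apply/seteqP; split=> t //= _ [|j]. Qed.

Lemma measurable_history (k : nat) (v : nat -> R) :
  measurable (history delta k v).
Proof.
case: k => [|k]; first by rewrite (_ : history _ _ _ = setT);
  [exact: measurableT | apply/seteqP; split=> t //= _ j; rewrite ltn0 andbF].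
elim: k => [|k IH]; first by rewrite history1.
by rewrite historyS//; apply: measurableI => //; exact: measurable_error_eq.
Qed.

Lemma eq_history (k : nat) (v w : nat -> R) :
  (forall j, (1 <= j < k)%N -> v j = w j) -> history delta k v = history delta k w.
Proof.
move=> vw; apply/seteqP; split=> t /= h j hj; first by rewrite h// vw.
by rewrite h// vw.
Qed.

(** All cases of [SR_error] take one form here: the errors of rounding up and down have weights
    theta and 1 - theta, and the weighted mean of the two roundings is the exact result, so the mean
    error is 0. *)
Lemma SR_error_two_point (k : nat) (exact : (nat -> R) -> R) (v : nat -> R) :
  SR_error beta p delta k exact -> P (history delta k v) != 0%E ->
  let H x := [set t | delta k t = x] `&` history delta k v in
  exists x1 x2 : R,
    [/\ x1 != x2, `|x1| <= u /\ `|x2| <= u,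
        pr (H x1) + pr (H x2) = pr (history delta k v)
      & pr (H x1) * x1 + pr (H x2) * x2 = 0].
Proof.
move=> hSR PH0 H; have [] := hSR v PH0; set x := exact v.
have u0 : 0 < u by exact: fp_unit_gt0.
have mH y : measurable (H y).
  by apply: measurableI; [exact: measurable_error_eq|exact: measurable_history].
have prH0 : pr (history delta k v) != 0.
  rewrite /pr fine_eq0 ?pr_fin//; exact: measurable_history.
(* When the result is exact the error is 0 with conditional probability 1; [u] then serves as a
   second, distinct point of mass 0. *)
have degenerate : cond_prob P [set t | delta k t = 0] (history delta k v) = 1 ->
    exists x1 x2 : R,
    [/\ x1 != x2, `|x1| <= u /\ `|x2| <= u,
        pr (H x1) + pr (H x2) = pr (history delta k v)
      & pr (H x1) * x1 + pr (H x2) * x2 = 0].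
  move=> /(congr1 (fun z => z * pr (history delta k v))).
  rewrite /cond_prob divfK// mul1r => E.
  have E2 : pr (H u) = 0.
    apply: le_anti; rewrite pr_ge0 andbT -(lerD2l (pr (H 0))) addr0.
    rewrite -prU//; last first.
      apply/seteqP; split=> t //= [[h _] [z0 _]].
      by move: u0; rewrite -z0 h ltxx.
    rewrite [leRHS]E; apply: pr_le; [exact: measurableU|exact: measurable_history|].
    by move=> t [[]|[]].
  exists 0, u; rewrite E2 normr0 lt_eqF// ltW// gtr0_norm// !addr0 mul0r mulr0.
  by split; rewrite ?addr0.
move=> hz hn hs; have [x0|/eqP x0] := eqVneq x 0; first exact/degenerate/hz.
have x0' := introN eqP x0.
have setE c : [set t | x * (1 + delta k t) = c] = [set t | delta k t = c / x - 1].
  apply/seteqP; split=> t /= => [<-|->]; first by field.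
  by field.
have [nx|nx] := pselect (fp_normal beta p x).
  by apply: degenerate; rewrite -(hn nx) setE divff// subrr.
have [] := hs x0 nx; rewrite !setE /cond_prob.
have [/andP[fx xc] cf] := fp_floor_ceil hbeta hp x x0 nx.
set c := fp_ceil beta p x; set f := fp_floor beta p x in fx xc cf *.
rewrite -/c in xc cf.
have cf0 : c - f != 0 by rewrite gt_eqF// subr_gt0 (lt_trans fx).
move=> /(congr1 (fun z => z * pr (history delta k v))); rewrite divfK// => E1.
move=> /(congr1 (fun z => z * pr (history delta k v))); rewrite divfK// => E2.
(* Any [y] between the two neighbours differs from [x] by at most their gap, which is at most
   [u * |x|]. *)
have bound y : f <= y <= c -> `|y / x - 1| <= u.
  move=> /andP[fy yc]; have -> : y / x - 1 = (y - x) / x by field.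
  rewrite normrM normfV ler_pdivrMr ?normr_gt0//; apply: le_trans cf.
  by rewrite ler_norml; apply/andP; split; lra.
exists (c / x - 1), (f / x - 1); split.
- rewrite (inj_eq (addIr _)) (inj_eq (mulIf _)) ?invr_eq0// gt_eqF//.
  exact: lt_trans xc.
- by rewrite !bound ?lexx ?andbT ?(ltW (lt_trans fx xc)).
- by rewrite [pr (H _)]E1 [pr (H (f / x - 1))]E2 -mulrDl subrKC mul1r.
- rewrite [pr (H _)]E1 [pr (H (f / x - 1))]E2 /fp_theta -/c -/f.
  by field; rewrite x0'.
Qed.

(* As the error has conditional mean 0 and square at most u ^ 2, a convex
   quadratic in it has conditional expectation at most a0 + a2 * u ^ 2. *)
Lemma SR_error_step (k : nat) (exact : (nat -> R) -> R) (v : nat -> R)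
    (E : set T) (K a0 a1 a2 : R) :
  (1 <= k)%N -> SR_error beta p delta k exact -> measurable E ->
  0 <= K -> 0 <= a2 ->
  (forall w : nat -> R, (forall j, (1 <= j < k)%N -> w j = v j) ->
    K * pr (E `&` history delta k.+1 w)
    <= pr (history delta k.+1 w) * (a0 + a1 * w k + a2 * w k ^+ 2)) ->
  K * pr (E `&` history delta k v)
  <= pr (history delta k v) * (a0 + a2 * u ^+ 2).
Proof.
move=> k1 hSR mE K0 a20 hw.
have mHv := measurable_history k v.
pose H x := [set t | delta k t = x] `&` history delta k v.
have mH x : measurable (H x).
  by apply: measurableI => //; exact: measurable_error_eq.
have hH x : K * pr (E `&` H x) <= pr (H x) * (a0 + a1 * x + a2 * x ^+ 2).
  (* Replacing the entry [k] of [v] by [x] extends the history to [H x]. *)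
  have agree j : (1 <= j < k)%N -> (if j == k then x else v j) = v j.
    by move=> /andP[_ jk]; rewrite ltn_eqF.
  have := hw _ agree; rewrite historyS// eqxx.
  by rewrite (eq_history _ _ _ agree).
have [PH0|PH0] := eqVneq (P (history delta k v)) 0%E.
  have prH0 : pr (history delta k v) = 0 by rewrite /pr PH0.
  have -> : pr (E `&` history delta k v) = 0.
    apply: le_anti; rewrite pr_ge0 andbT -prH0.
    by apply: pr_le => //; exact: measurableI.
  by rewrite prH0 mulr0 mul0r.
have [x1 [x2 []]] := SR_error_two_point _ _ _ hSR PH0.
rewrite -/(H x1) -/(H x2) => x12 [ux1 ux2] prD prM.
have disj : H x1 `&` H x2 = set0.
  apply/seteqP; split=> t //= [[h1 _] [h2 _]].
  by move: x12; rewrite -h1 -h2 eqxx.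
have mHU : measurable (H x1 `|` H x2) by exact: measurableU.
(* The two values carry all the mass of the history, so [E] need only be measured on [H x1] and
   [H x2]. *)
have rest0 : pr (history delta k v `\` (H x1 `|` H x2)) = 0.
  have : pr (history delta k v) = pr (H x1 `|` H x2)
           + pr (history delta k v `\` (H x1 `|` H x2)).
    rewrite -prU//; last by apply/seteqP; split=> t //= -[h [_ /(_ h)]].
      by rewrite setDUK// => t [[]|[]].
    exact: measurableD.
  by rewrite prU//; lra.
have split_le : pr (E `&` history delta k v)
    <= pr (E `&` H x1) + pr (E `&` H x2).
  have mE1 := measurableI _ _ mE (mH x1); have mE2 := measurableI _ _ mE (mH x2).
  have mD : measurable (history delta k v `\` (H x1 `|` H x2)).
    exact: measurableD.
  have mU := measurableU _ _ mE1 mE2.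
  rewrite -[leRHS]addr0 -rest0 -prU//; last first.
    by apply/seteqP; split=> t //= -[[_ h1] [_ h2]]; have : (H x1 `&` H x2) t by []; rewrite disj.
  rewrite -prU//; last first.
    apply/seteqP; split=> t //= -[[[_ h]|[_ h]] [_ n]]; apply: n; by [left|right].
  apply: pr_le; [exact: measurableI|exact: measurableU|].
  move=> t [Et Ht]; have [h|h] := pselect ((H x1 `|` H x2) t); last by right.
  by left; case: h => h; [left|right].
have sq x : `|x| <= u -> x ^+ 2 <= u ^+ 2.
  by move=> ux; rewrite -real_normK ?num_real// lerXn2r// nnegrE (le_trans _ ux).
have q1 : pr (H x1) * (a2 * x1 ^+ 2) <= pr (H x1) * (a2 * u ^+ 2).
  by rewrite ler_wpM2l// ler_wpM2l// sq.
have q2 : pr (H x2) * (a2 * x2 ^+ 2) <= pr (H x2) * (a2 * u ^+ 2).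
  by rewrite ler_wpM2l// ler_wpM2l// sq.
apply: le_trans (ler_wpM2l K0 split_le) _; rewrite mulrDr.
apply: le_trans (lerD (hH x1) (hH x2)) _.
(* Grouping by powers isolates the mean, which multiplies [a1] and vanishes. *)
have -> : pr (H x1) * (a0 + a1 * x1 + a2 * x1 ^+ 2)
    + pr (H x2) * (a0 + a1 * x2 + a2 * x2 ^+ 2)
  = (pr (H x1) + pr (H x2)) * a0 + a1 * (pr (H x1) * x1 + pr (H x2) * x2)
    + (pr (H x1) * (a2 * x1 ^+ 2) + pr (H x2) * (a2 * x2 ^+ 2)) by ring.
by rewrite prM mulr0 addr0 -prD mulrDr lerD2l mulrDl lerD.
Qed.

End RoundingStep.

(** * Computed partial sums as functions of the errors *)

Lemma computed_sumS (R : realType) (a b dl : nat -> R) (i : nat) : (1 <= i)%N ->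
  computed_sum a b dl i.+1 =
  (computed_sum a b dl i + a i.+1 * b i.+1 * (1 + dl (2 * i)%N))
  * (1 + dl (2 * i).+1).
Proof. case: i => // i _.
have <- : (2 * i.+2 - 2 = 2 * i.+1)%N by rewrite mulnS addKn.
by have -> : ((2 * i.+2 - 2).+1 = 2 * i.+2 - 1)%N by rewrite mulnS. Qed.

(** The partial sum [i] involves only the errors 1 to 2i - 1, hence is constant on each history of
    index [2 * i]. *)
Lemma eq_computed_sum (R : realType) (a b v w : nat -> R) (i : nat) :
  (forall j, (1 <= j < 2 * i)%N -> v j = w j) ->
  computed_sum a b v i = computed_sum a b w i.
Proof.
elim: i => [//|[_ vw|i IH vw]]; first by rewrite /= vw.
rewrite 2?(computed_sumS _ _ _ _ i.+1)// (IH _); last by move=> j hj; apply: vw; lia.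
by rewrite !vw//; lia.
Qed.

Lemma measurable_computed_sum (R : realType) (d : measure_display)
    (T : measurableType d) (P : probability T R) (delta : nat -> {RV P >-> R})
    (a b : nat -> R) (i : nat) :
  measurable_fun setT (fun t => computed_sum a b (fun k => delta k t) i).
Proof.
have mdelta k : measurable_fun setT (fun t => 1 + delta k t).
  by apply: measurable_funD => //; exact: measurable_funP.
elim: i => [|[_|i IH]]; first exact: measurable_cst.
  by apply: measurable_funM => //; exact: measurable_cst.
apply: (eq_measurable_fun (fun t =>
  (computed_sum a b (fun k => delta k t) i.+1
   + a i.+2 * b i.+2 * (1 + delta (2 * i.+1)%N t)) * (1 + delta (2 * i.+1).+1 t))).
  by move=> t _; rewrite [RHS]computed_sumS.
apply: measurable_funM => //; apply: measurable_funD => //.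
by apply: measurable_funM => //; exact: measurable_cst.
Qed.

(** * Backward induction on the second moment of the error *)

Section BackwardInduction.
Context {R : realType} {beta p : nat}.
Hypotheses (hbeta : (2 <= beta)%N) (hp : (1 <= p)%N).
Context {d : measure_display} {T : measurableType d} {P : probability T R}.
Variable delta : nat -> {RV P >-> R}.
Variables (n : nat) (a b : nat -> R).
Hypothesis h1 : SR_error beta p delta 1 (fun _ => a 1%N * b 1%N).
Hypothesis hprod : forall i : nat, (2 <= i <= n)%N ->
  SR_error beta p delta (2 * i - 2) (fun _ => a i * b i).
Hypothesis hadd : forall i : nat, (2 <= i <= n)%N ->
  SR_error beta p delta (2 * i - 1)
    (fun dl => computed_sum a b dl (i - 1)
               + a i * b i * (1 + dl (2 * i - 2)%N)).

Let q : R := 1 + fp_unit beta p ^+ 2.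
Let y : R := inner_prod n a b.
Let rest (i : nat) : R := \sum_(i.+1 <= j < n.+1) a j * b j.
Let abs_rest (i : nat) : R := \sum_(i.+1 <= j < n.+1) `|a j * b j|.

Let q1 : 1 <= q. Proof. by rewrite lerDl sqr_ge0. Qed.

(* [q ^+ m * s ^+ 2 + 2 * B * s + C - 2 * y * (s + rest i) + y ^+ 2] bounds the
   conditional expectation of the square of the final error when the partial
   sum [i = n - m] has been computed as s: the first three terms come from the
   second moment of the final result, and [s + rest i] is its mean. *)
Lemma sq_error_bound_from (E : set T) (K : R) (m i : nat) :
  measurable E -> 0 <= K ->
  (forall v : nat -> R,
    K * fine (P (E `&` history delta (2 * n) v))
    <= fine (P (history delta (2 * n) v)) * (computed_sum a b v n - y) ^+ 2) ->
  (1 <= i)%N -> (i + m)%N = n ->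
  exists B C : R,
    [/\ `|B - rest i| <= (q ^+ m - 1) * abs_rest i,
        C <= rest i ^+ 2 + (q ^+ m.+1 - 1) * abs_rest i ^+ 2
      & forall v : nat -> R,
        K * fine (P (E `&` history delta (2 * i) v))
        <= fine (P (history delta (2 * i) v))
           * (q ^+ m * computed_sum a b v i ^+ 2
              + 2 * B * computed_sum a b v i + C
              - 2 * y * (computed_sum a b v i + rest i) + y ^+ 2)].
Proof.
move=> mE K0 hE; elim: m i => [|m IH] i i1 imn.
  rewrite addn0 in imn; subst i; exists 0, 0.
  rewrite /rest /abs_rest !big_geq//; split.
  - by rewrite subr0 normr0 mulr0.
  - by rewrite expr0n /= mulr0 addr0.
  - move=> v; apply: le_trans (hE v) _.
    by rewrite le_eqVlt; apply/orP; left; apply/eqP; ring.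
have [//||B [C [hB hC hv]]] := IH i.+1; first by rewrite addSnnS.
have i2 : (2 <= i.+1 <= n)%N by lia.
set c : R := a i.+1 * b i.+1.
have restE : rest i = c + rest i.+1 by rewrite /rest big_ltn//; lia.
have absE : abs_rest i = `|c| + abs_rest i.+1 by rewrite /abs_rest big_ltn//; lia.
have abs0 : 0 <= abs_rest i.+1 by exact: sumr_ge0.
have qm : 1 <= q ^+ m by rewrite exprn_ege1.
have qS k : q ^+ k.+1 = q * q ^+ k by rewrite exprS.
set r := rest i.+1 in hB hC hv restE *; set A := abs_rest i.+1 in hB hC absE abs0 *.
(* Averaging over the addition error turns [q ^+ m] into [q ^+ m.+1]; averaging
   [(s + c * (1 + x)) ^+ 2] over the product error x then gives [(s + c) ^+ 2 + u ^ 2 * c ^+ 2]. The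
   coefficients of [s] and 1 in the result are these witnesses. *)
exists (q ^+ m.+1 * c + B), (q ^+ m.+2 * c ^+ 2 + 2 * B * c + C); split.
- rewrite restE absE.
  have -> : q ^+ m.+1 * c + B - (c + r) = (q ^+ m.+1 - 1) * c + (B - r) by ring.
  apply: le_trans (ler_normD _ _) _; rewrite mulrDr lerD//.
    by rewrite normrM ger0_norm// subr_ge0 exprn_ege1.
  by apply: le_trans hB _; rewrite ler_wpM2r// lerD2r qS ler_peMl// (le_trans _ qm).
- rewrite restE absE.
  (* All exponents are raised to [m.+2], so that the excess terms assemble into the square of
     [|c| + A]. *)
  have cB : 2 * ((B - r) * c) <= 2 * ((q ^+ m.+2 - 1) * A * `|c|).
    rewrite ler_wpM2l//; apply: le_trans (ler_norm _) _; rewrite normrM ler_wpM2r//.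
    apply: le_trans hB _; rewrite ler_wpM2r// lerD2r ler_weXn2l//.
    by lia.
  have cC : C <= r ^+ 2 + (q ^+ m.+2 - 1) * A ^+ 2.
    apply: le_trans hC _; rewrite lerD2l ler_wpM2r ?sqr_ge0// lerD2r.
    by rewrite [leRHS]qS ler_peMl// exprn_ge0// (le_trans ler01).
  have cE := real_normK (num_real c).
  by rewrite -cE; lra.
- move=> v; set s := computed_sum a b v i.
  have kp : SR_error beta p delta (2 * i) (fun _ => c).
    by have := hprod _ i2; rewrite (_ : 2 * i.+1 - 2 = 2 * i)%N//; lia.
  have ka := hadd _ i2; rewrite (_ : 2 * i.+1 - 1 = (2 * i).+1)%N in ka; last by lia.
  have e2 : (2 * i.+1 = (2 * i).+2)%N by lia.
  pose F : R := q ^+ m.+1.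
  have F0 : 0 <= F by rewrite exprn_ge0// (le_trans ler01).
  have G0 : 0 <= q ^+ m by exact: le_trans qm.
  have hv1 w : K * fine (P (E `&` history delta (2 * i).+1 w))
      <= fine (P (history delta (2 * i).+1 w))
         * (F * (computed_sum a b w i + c * (1 + w (2 * i)%N)) ^+ 2
            + 2 * B * (computed_sum a b w i + c * (1 + w (2 * i)%N)) + C
            - 2 * y * (computed_sum a b w i + c * (1 + w (2 * i)%N) + r)
            + y ^+ 2).
    set s' := computed_sum a b w i + c * (1 + w (2 * i)%N).
    (* The coefficients come from substituting [s' * (1 + x)] for the next partial sum and expanding
       in the addition error x. *)
    have := @SR_error_step _ _ _ hbeta hp _ _ _ delta _ _ w E K
      (q ^+ m * s' ^+ 2 + 2 * B * s' + C - 2 * y * (s' + r) + y ^+ 2)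
      (2 * q ^+ m * s' ^+ 2 + 2 * B * s' - 2 * y * s')
      (q ^+ m * s' ^+ 2) (ltn0Sn _) ka mE K0.
    rewrite mulr_ge0 ?sqr_ge0// => /(_ isT) step; apply: le_trans (step _) _.
      move=> w' ww'; have := hv w'; rewrite e2 computed_sumS// -/c.
      rewrite (eq_computed_sum _ _ _ w' w); last by move=> j hj; apply: ww'; lia.
      rewrite (ww' (2 * i)%N); last by lia.
      rewrite -/s' => /le_trans; apply.
      by rewrite le_eqVlt; apply/orP; left; apply/eqP; ring.
    by rewrite le_eqVlt; apply/orP; left; apply/eqP; rewrite /F qS -/s' /q; ring.
  (* The same expansion for the product error, which enters through [s + c * (1 + x)]. *)
  have := @SR_error_step _ _ _ hbeta hp _ _ _ delta _ _ v E K
    (F * (s + c) ^+ 2 + 2 * B * (s + c) + C - 2 * y * (s + c + r) + y ^+ 2)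
    (2 * F * (s + c) * c + 2 * B * c - 2 * y * c)
    (F * c ^+ 2) _ kp mE K0.
  rewrite mulr_ge0 ?sqr_ge0// => step; apply: le_trans (step _ isT _) _.
  + by lia.
  + move=> w wv; have := hv1 w.
    rewrite (eq_computed_sum _ _ _ w v); last by move=> j hj; apply: wv; lia.
    move=> /le_trans; apply.
    by rewrite le_eqVlt; apply/orP; left; apply/eqP; rewrite -/s /=; ring.
  + rewrite le_eqVlt; apply/orP; left; apply/eqP.
    by rewrite (qS m.+1) -/F restE /q; ring.
Qed.

(** After the recursion has descended to the first partial sum, only the error of the first product
    remains to be averaged. *)
Lemma sq_error_bound (E : set T) (K : R) : (1 <= n)%N ->
  measurable E -> 0 <= K ->
  (forall v : nat -> R,
    K * fine (P (E `&` history delta (2 * n) v))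
    <= fine (P (history delta (2 * n) v)) * (computed_sum a b v n - y) ^+ 2) ->
  K * fine (P E)
  <= gamma_err n (fp_unit beta p ^+ 2) * (\sum_(1 <= i < n.+1) `|a i * b i|) ^+ 2.
Proof.
move=> n1 mE K0 hE.
have [//||B [C [hB hC hv]]] := sq_error_bound_from E K n.-1 1 mE K0 hE.
  by rewrite add1n prednK.
rewrite prednK// in hC.
set c : R := a 1%N * b 1%N.
have yE : y = c + rest 1 by rewrite /y /inner_prod big_ltn.
rewrite big_ltn// -/c -/(abs_rest 1) /gamma_err -/q.
set r := rest 1 in hB hC hv yE *; set A := abs_rest 1 in hB hC *.
have A0 : 0 <= A by exact: sumr_ge0.
have G0 : 0 <= q ^+ n.-1 by rewrite exprn_ge0// (le_trans ler01).
have qn : q ^+ n = q * q ^+ n.-1 by rewrite -exprS prednK.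
(* The history of index 1 is the whole space whatever the sequence chosen, so the resulting bound is
   unconditional. *)
have := @SR_error_step _ _ _ hbeta hp _ _ _ delta _ _ (fun=> 0) E K
  (q ^+ n.-1 * c ^+ 2 + 2 * B * c + C - 2 * y * (c + r) + y ^+ 2)
  (2 * q ^+ n.-1 * c ^+ 2 + 2 * B * c - 2 * y * c)
  (q ^+ n.-1 * c ^+ 2) (ltn0Sn _) h1 mE K0.
rewrite mulr_ge0 ?sqr_ge0// => /(_ isT) step.
rewrite history1 setIT probability_setT mul1r in step.
apply: le_trans (step _) _.
  move=> w _; have := hv w; rewrite muln1 => /le_trans; apply.
  by rewrite le_eqVlt; apply/orP; left; apply/eqP; rewrite /= -/c; ring.
have cB : 2 * ((B - r) * c) <= 2 * ((q ^+ n - 1) * A * `|c|).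
  rewrite ler_wpM2l//; apply: le_trans (ler_norm _) _; rewrite normrM ler_wpM2r//.
  by apply: le_trans hB _; rewrite ler_wpM2r// lerD2r ler_weXn2l// leq_pred.
have cE := real_normK (num_real c).
have qE : q ^+ n.-1 * c ^+ 2 * fp_unit beta p ^+ 2
    = q ^+ n * c ^+ 2 - q ^+ n.-1 * c ^+ 2 by rewrite qn /q; ring.
by rewrite qE yE -cE; lra.
Qed.

End BackwardInduction.

(** * Markov's inequality applied to the squared error *)

Theorem mainTheorem5 (R : realType) (beta p : nat)
  (hbeta : (2 <= beta)%N) (hp : (1 <= p)%N)
  (d : measure_display) (T : measurableType d) (P : probability T R)
  (n : nat) (hn : (1 <= n)%N) (a b : nat -> R)
  (hy : inner_prod n a b != 0)
  (delta : nat -> {RV P >-> R})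
  (h1 : SR_error beta p delta 1 (fun _ => a 1%N * b 1%N))
  (hprod : forall i : nat, (2 <= i <= n)%N ->
    SR_error beta p delta (2 * i - 2) (fun _ => a i * b i))
  (hadd : forall i : nat, (2 <= i <= n)%N ->
    SR_error beta p delta (2 * i - 1)
      (fun dl => computed_sum a b dl (i - 1)
                 + a i * b i * (1 + dl (2 * i - 2)%N)))
  (lambda : R) (hlambda : 0 < lambda < 1) :
  let y := inner_prod n a b in
  let yhat (t : T) := computed_sum a b (fun k => delta k t) n in
  let bound := cond_number1 n a b
               * Num.sqrt (gamma_err n (fp_unit beta p ^+ 2) / lambda) in
  ((1 - lambda)%:E <= P [set t | `|yhat t - y| / `|y| <= bound]%R)%E.
Proof.
cbv zeta; set y := inner_prod n a b; set bound := cond_number1 n a b * _.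
pose yhat (t : T) := computed_sum a b (fun k => delta k t) n.
set g := gamma_err n (fp_unit beta p ^+ 2) in bound *.
set A : R := \sum_(1 <= i < n.+1) `|a i * b i|.
have y0 : 0 < `|y| by rewrite normr_gt0.
have A0 : 0 < A by apply: lt_le_trans y0 _; exact: ler_norm_sum.
have u0 : 0 < fp_unit beta p :> R by exact: fp_unit_gt0.
have g0 : 0 < g by rewrite subr_gt0 exprn_egt1 ?ltrDl ?exprn_gt0// -lt0n.
have /andP[l0 l1] := hlambda.
have gl0 : 0 < g / lambda by rewrite divr_gt0.
have bound0 : 0 <= bound.
  by rewrite mulr_ge0 ?sqrtr_ge0// divr_ge0// ltW.
(* The threshold K of the Markov argument is the square of [bound * |y|]; its positivity allows
   cancelling it at the end. *)
have Kpos : 0 < A ^+ 2 * (g / lambda) by rewrite mulr_gt0 ?exprn_gt0.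
have boundE : (bound * `|y|) ^+ 2 = A ^+ 2 * (g / lambda).
  rewrite /bound /cond_number1 -/(inner_prod n a b) -/y -/A mulrAC divfK ?gt_eqF//.
  by rewrite exprMn sqr_sqrtr// ltW.
set G := [set t | _].
have mG : measurable G.
  have mf : measurable_fun setT (fun t => `|yhat t - y| / `|y| <= bound).
    apply: measurable_fun_ler => //; apply: measurable_funM => //.
    apply: measurableT_comp => //; apply: measurable_funB => //.
    exact: measurable_computed_sum.
  have -> : G = (fun t => `|yhat t - y| / `|y| <= bound) @^-1` [set true].
    by apply/seteqP; split=> t.
  by rewrite -[X in measurable X]setTI; exact: mf.
have mC : measurable (~` G) by exact: measurableC.
(* The computed value is constant on the history, so either the bad event misses the history or the
   squared error exceeds K on all of it. *)
have hE v : A ^+ 2 * (g / lambda) * fine (P (~` G `&` history delta (2 * n) v))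
    <= fine (P (history delta (2 * n) v)) * (computed_sum a b v n - y) ^+ 2.
  have mH := measurable_history delta (2 * n) v.
  have [[t [Gt Ht]]|none] := pselect (exists t, (~` G `&` history delta (2 * n) v) t).
    rewrite mulrC; apply: ler_pM; rewrite ?fine_ge0 ?(ltW Kpos)//.
      rewrite fine_le ?fin_num_measure//; first exact: measurableI.
      by rewrite le_measure ?inE//; exact: measurableI.
    have yt : yhat t = computed_sum a b v n by apply: eq_computed_sum.
    move/negP: Gt; rewrite -ltNge ltr_pdivlMr// -/(yhat t) yt -boundE => /ltW lt_e.
    by rewrite -[leRHS]real_normK ?num_real// lerXn2r ?nnegrE// mulr_ge0// ltW.
  have -> : ~` G `&` history delta (2 * n) v = set0.
    by apply/seteqP; split=> t // h; apply: none; exists t.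
  by rewrite measure0 mulr0 mulr_ge0 ?sqr_ge0 ?fine_ge0.
have := sq_error_bound hbeta hp delta n a b h1 hprod hadd (~` G) _ hn mC (ltW Kpos) hE.
rewrite -/g -/A => le_gA.
(* The second-moment bound [g * A ^+ 2] equals [lambda] times K. *)
have le_l : fine (P (~` G)) <= lambda.
  rewrite -(ler_pM2l Kpos); apply: le_trans le_gA _.
  by rewrite mulrA divfK ?gt_eqF// mulrC.
have PG : P G \is a fin_num by exact: fin_num_measure.
move: le_l; rewrite probability_setC// -(fineK PG) -EFinB /= lee_fin.
by rewrite lerBlDr -lerBlDl.
Qed.
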